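(* Let $J_0\in\mathbb N_0$ and let $J\ge J_0$ be an integer. Let $\Psi=\{\alpha;\beta^1,\ldots,\beta^r\}\subset L_1(\mathbb R)$ ($r\ge1$) be framelet generators satisfying: (a) $\lim_{j\to\infty}|\widehat\alpha(\lambda_\ell/2^j)|=1$ for every $\ell\ge0$; (b) $|\widehat\alpha(\lambda_\ell/2^{j+1})|^2=|\widehat\alpha(\lambda_\ell/2^j)|^2+\sum_{k=1}^r|\widehat{\beta^k}(\lambda_\ell/2^j)|^2$ for every $j\ge J$ and $\ell\ge0$; (c) $(\operatorname{supp}\widehat\alpha\cap[0,\infty))\cup\bigcup_{k=1}^r(\operatorname{supp}\widehat{\beta^k}\cap[0,\infty))\subset[0,1]$. Let $0<\eta<1$, and let $\{\boldsymbol X_j\}_{j\ge0}$, $\{w_{j,x}\}$ be fixed-tolerance dyadic nested Marcinkiewicz--Zygmund measures for $p=2$ with tolerance $\eta$ and parameter $\gamma_{\eta,2,\mathcal M}$ (see context). Then the semi-discrete framelet system $$\mathrm{FS}_J(\Psi;\boldsymbol X,w)=\{w_{J,x}^{1/2}\varphi_{J,x}:x\in\boldsymbol X_J\}\cup\{w_{j+1,x}^{1/2}\psi^k_{j,x}:x\in\boldsymbol X_{j+1},\ j\ge J,\ k=1,\ldots,r\}$$ is an $\eta$-nearly tight frame for $L^2(\mathcal M,\mu)$, with frame bounds $1-\eta$ and $1+\eta$; that is, for all $f\in L^2(\mathcal M,\mu)$, $$(1-\eta)\|f\|_{L^2(\mu)}^2\le\sum_{x\in\boldsymbol X_J}|\langle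 f,w_{J,x}^{1/2}\varphi_{J,x}\rangle|^2+\sum_{j\ge J}\sum_{k=1}^r\sum_{x\in\boldsymbol X_{j+1}}|\langle f,w_{j+1,x}^{1/2}\psi^k_{j,x}\rangle|^2\le(1+\eta)\|f\|_{L^2(\mu)}^2 .$$
   Context: $(\mathcal M,g)$ is a compact, connected, $d$-dimensional smooth Riemannian manifold without boundary, and $\mu$ is its Riemannian volume measure normalized so that $\mu(\mathcal M)=1$. $\{u_\ell\}_{\ell\ge0}$ is an orthonormal basis of $L^2(\mu)$ with $-\Delta_{\mathcal M}u_\ell=\lambda_\ell^2u_\ell$ ($\Delta_{\mathcal M}$ the Laplace--Beltrami operator), $0=\lambda_0\le\lambda_1\le\cdots\to\infty$, and $\mathbb P_n=\operatorname{span}\{u_\ell:\lambda_\ell\le n\}$. $\langle f,g\rangle=\int f\overline g\,d\mu$. Fourier convention: $\widehat h(\xi)=\int_{\mathbb R}h(t)e^{-2\pi it\xi}\,dt$. The generators have Fourier transforms compactly supported on the nonnegative frequency axis. Framelet kernels, for $j\ge J$, $x,y\in\mathcal M$: $$\varphi_{j,y}(x)=\sum_{\ell\ge0}\widehat\alpha(\lambda_\ell/2^j)\overline{u_\ell(y)}u_\ell(x),\qquad \psi^k_{j,y}(x)=\sum_{\ell\ge0}\widehat{\beta^k}(\lambda_\ell/2^j)\overline{u_\ell(y)}u_\ell(x).$$ Fixed-tolerance dyadic nested Marcinkiewicz--Zygmund measures for $p=2$, tolerance $\eta$, parameter $\gamma_{\eta,2,\mathcal M}>0$: nested finite sets $\boldsymbol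 X_j\subset\boldsymbol X_{j+1}\subset\mathcal M$, $j\ge0$, and positive weights $w_{j,x}$, $x\in\boldsymbol X_j$, with $|\boldsymbol X_j|\asymp\gamma_{\eta,2,\mathcal M}^{-d}2^{jd}$ and $w_{j,x}\asymp\gamma_{\eta,2,\mathcal M}^{d}2^{-jd}$ (implicit constants depending only on $\mathcal M$), and $$(1-\eta)\|P\|_{L^2(\mu)}^2\le\sum_{x\in\boldsymbol X_j}w_{j,x}|P(x)|^2\le(1+\eta)\|P\|_{L^2(\mu)}^2\qquad\text{for all }P\in\mathbb P_{2^j},\ j\ge0.$$ A system is $\varepsilon$-nearly tight ($0\le\varepsilon<1$) if its squared coefficient sum lies between $(1-\varepsilon)\|f\|^2$ and $(1+\varepsilon)\|f\|^2$ for all $f\in L^2(\mathcal M,\mu)$. *)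

(* Defs.v *)
From HB Require Import structures.
From mathcomp Require Import all_boot all_order all_algebra finmap.
From mathcomp Require Export complex.
From mathcomp Require Import all_classical all_reals all_analysis.
Set Implicit Arguments.
Unset Strict Implicit.
Unset Printing Implicit Defensive.
Import Order.TTheory GRing.Theory Num.Theory.
Import numFieldNormedType.Exports.
Local Open Scope classical_set_scope.
Local Open Scope ring_scope.

Definition partial (R : realType) (d : nat) (a : 'I_d) (f : 'rV[R]_d -> R)
  : 'rV[R]_d -> R := fun x => 'D_(delta_mx 0 a) f x.

(* C^oo on an open set: all iterated partial derivatives exist and are
   continuous there. *)
Definition smooth_on (R : realType) (d : nat) (V : set 'rV[R]_d)
    (f : 'rV[R]_d -> R) : Prop :=
  forall (s : seq 'I_d) (x : 'rV[R]_d), V x ->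
    {for x, continuous (foldr (@partial R d) f s)} /\
    (forall a : 'I_d, derivable (foldr (@partial R d) f s) x (delta_mx 0 a)).

(* Lebesgue integral over R^d as an iterated one-dimensional integral; it is
   only applied to nonnegative Borel functions, where Tonelli's theorem
   applies. *)
Fixpoint lebesgue_int (R : realType) (d : nat) {struct d}
    : ('rV[R]_d -> \bar R) -> \bar R :=
  match d return ('rV[R]_d -> \bar R) -> \bar R with
  | 0 => fun f => f 0
  | d'.+1 => fun f =>
      (\int[lebesgue_measure]_(t in [set: R])
         lebesgue_int (fun y : 'rV[R]_d' => f (row_mx (t%:M : 'rV[R]_1) y)))%E
  end.

(* A smooth d-manifold without boundary given by an atlas; the metric is given
   by its Gram matrices in the coordinates of each chart.  The values of
   [coord i], [param i] and [metric i] outside [dom i], resp. its image, are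
   irrelevant. *)
Record riemannian_manifold (R : realType) (d : nat) (M : topologicalType) := {
  chart : Type;
  dom : chart -> set M;
  coord : chart -> M -> 'rV[R]_d;
  param : chart -> 'rV[R]_d -> M;
  metric : chart -> 'rV[R]_d -> 'M[R]_d;
  manifold_hausdorff : hausdorff_space M;
  manifold_second_countable : @second_countable M;
  dom_open : forall i, open (dom i);
  dom_cover : forall p, exists i, dom i p;
  image_open : forall i, open (coord i @` dom i);
  coord_continuous :
    forall i p, dom i p -> {for p, continuous (coord i)};
  param_continuous :
    forall i x, (coord i @` dom i) x -> {for x, continuous (param i)};
  coordK : forall i p, dom i p -> param i (coord i p) = p;
  transition_smooth : forall i j (a : 'I_d),
    smooth_on (coord i @` (dom i `&` dom j))
      (fun x => coord j (param i x) 0 a);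
  metric_smooth : forall i (a b : 'I_d),
    smooth_on (coord i @` dom i) (fun x => metric i x a b);
  metric_sym : forall i p, dom i p ->
    (metric i (coord i p))^T = metric i (coord i p);
  metric_posdef : forall i p (v : 'rV[R]_d), dom i p -> v != 0 ->
    0 < (v *m metric i (coord i p) *m v^T) 0 0;
  metric_transition : forall i j p, dom i p -> dom j p ->
    let jac := \matrix_(a < d, b < d)
      partial a (fun x => coord j (param i x) 0 b) (coord i p) in
    metric i (coord i p) = jac *m metric j (coord j p) *m jac^T
}.

Notation borel M := (g_sigma_algebraType (@open M)).

Definition sqrt_det_metric (R : realType) (d : nat) (M : topologicalType)
    (G : riemannian_manifold R d M) (i : chart G) (x : 'rV[R]_d) : R :=
  Num.sqrt (\det (metric i x)).

Definition riemannian_volume (R : realType) (d : nat) (M : ptopologicalType)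
    (G : riemannian_manifold R d M)
    (vol : {measure set (borel M) -> \bar R}) : Prop :=
  forall (i : chart G) (A : set (borel M)), measurable A -> A `<=` dom i ->
    vol A = lebesgue_int
      (fun x => (\1_(coord i @` A) x * sqrt_det_metric i x)%:E).

Definition normalized_volume (R : realType) (d : nat) (M : ptopologicalType)
    (G : riemannian_manifold R d M) (mu : probability (borel M) R) : Prop :=
  exists vol : {measure set (borel M) -> \bar R},
    [/\ riemannian_volume G vol,
        (0 < vol [set: M] < +oo)%E
      & forall A : set (borel M), measurable A ->
          mu A = (((fine (vol [set: M]))^-1)%:E * vol A)%E].

Definition smooth_map (R : realType) (d : nat) (M : topologicalType)
    (G : riemannian_manifold R d M) (f : M -> R) : Prop :=
  forall i : chart G, smooth_on (coord i @` dom i) (f \o param i).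

(* The Laplace-Beltrami operator div grad in the coordinates of chart [i],
   |g|^(-1/2) sum_a d_a (|g|^(1/2) sum_b g^(ab) d_b f), at the point [p]. *)
Definition laplace_beltrami (R : realType) (d : nat) (M : topologicalType)
    (G : riemannian_manifold R d M) (i : chart G) (f : M -> R) (p : M) : R :=
  (sqrt_det_metric i (coord i p))^-1 *
  \sum_(a < d) partial a
    (fun x => sqrt_det_metric i x *
       \sum_(b < d) invmx (metric i x) a b * partial b (f \o param i) x)
    (coord i p).

(* Eigenfunctions are smooth, so  - Laplacian u = lam^2 u  is imposed pointwise;
   the real operator acts on real and imaginary parts. *)
Definition laplace_eigenfunction (R : realType) (d : nat) (M : topologicalType)
    (G : riemannian_manifold R d M) (lam : R) (u : M -> R[i]) : Prop :=
  [/\ smooth_map G (fun p => complex.Re (u p)),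
      smooth_map G (fun p => complex.Im (u p))
    & forall (i : chart G) (p : M), dom i p ->
        - laplace_beltrami i (fun q => complex.Re (u q)) p
          = lam ^+ 2 * complex.Re (u p) /\
        - laplace_beltrami i (fun q => complex.Im (u q)) p
          = lam ^+ 2 * complex.Im (u p)].

Notation cmod := ComplexField.Normc.normc.

Section ComplexIntegration.
Context {disp : measure_display} {T : measurableType disp} {R : realType}.
Variable mu : {measure set T -> \bar R}.
Implicit Types f g : T -> R[i].

Definition cintegrable f : Prop :=
  mu.-integrable [set: T] (fun x => (complex.Re (f x))%:E) /\
  mu.-integrable [set: T] (fun x => (complex.Im (f x))%:E).

Definition cintegral f : R[i] :=
  Complex (\int[mu]_(x in [set: T]) complex.Re (f x))
          (\int[mu]_(x in [set: T]) complex.Im (f x)).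

(* Elements of L^2(mu) are represented by functions, not by classes modulo
   equality almost everywhere. *)
Definition L2 f : Prop :=
  [/\ measurable_fun [set: T] (fun x => complex.Re (f x)),
      measurable_fun [set: T] (fun x => complex.Im (f x))
    & (\int[mu]_(x in [set: T]) ((cmod (f x)) ^+ 2)%:E < +oo)%E].

Definition L2norm f : R :=
  Num.sqrt (\int[mu]_(x in [set: T]) (cmod (f x)) ^+ 2).

Definition inner f g : R[i] := cintegral (fun x => f x * conjc (g x)).

(* Completeness is the density of the linear span in L^2(mu). *)
Definition orthonormal_basis (u : nat -> T -> R[i]) : Prop :=
  [/\ forall l, L2 (u l),
      forall l m, inner (u l) (u m) = (l == m)%:R
    & forall f, L2 f -> forall e : R, 0 < e ->
        exists (N : nat) (c : nat -> R[i]),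
          L2norm (fun x => f x - \sum_(0 <= l < N) c l * u l x) < e].

End ComplexIntegration.

Definition fourier (R : realType) (h : R -> R[i]) (xi : R) : R[i] :=
  cintegral lebesgue_measure (fun t : R =>
    h t * Complex (cos (- (2 * pi * t * xi))) (sin (- (2 * pi * t * xi)))).

Definition support_fourier (R : realType) (h : R -> R[i]) : set R :=
  closure [set xi | fourier h xi != 0].

(* Membership in P_n = span {u_l : lam_l <= n}. *)
Definition diffusion_polynomial (R : realType) (M : Type) (lam : nat -> R)
    (u : nat -> M -> R[i]) (n : nat) (P : M -> R[i]) : Prop :=
  exists (N : nat) (c : nat -> R[i]),
    P = (fun x => \sum_(0 <= l < N | lam l <= n%:R) c l * u l x).

(* Sum of a complex series, as the limit of the real and imaginary parts of
   its partial sums. *)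
Definition cseries (R : realType) (a : nat -> R[i]) : R[i] :=
  Complex (limn (fun n : nat => complex.Re (\sum_(0 <= l < n) a l)))
          (limn (fun n : nat => complex.Im (\sum_(0 <= l < n) a l))).

(* With h = alpha this is phi_(j,y); with h = beta^k it is psi^k_(j,y). *)
Definition framelet (R : realType) (M : Type) (lam : nat -> R)
    (u : nat -> M -> R[i]) (h : R -> R[i]) (j : nat) (y x : M) : R[i] :=
  cseries (fun l => fourier h (lam l / 2 ^+ j) * conjc (u l y) * u l x).

(* The constants [c], [C] witness the two-sided estimates written with an
   asymptotic-equivalence sign; they are parameters so that they can be
   quantified before the tolerance, the points and the weights. *)
Definition dyadic_nested_MZ (R : realType) (d : nat) (M : ptopologicalType)
    (mu : {measure set (borel M) -> \bar R}) (lam : nat -> R)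
    (u : nat -> M -> R[i]) (c C eta gamma : R)
    (X : nat -> {fset M}) (w : nat -> M -> R) : Prop :=
  [/\ forall j, (X j `<=` X j.+1)%fset,
      forall j x, x \in X j -> 0 < w j x,
      forall j, c * (gamma ^- d * 2 ^+ (j * d)) <= (#|` X j|)%:R
                  <= C * (gamma ^- d * 2 ^+ (j * d)),
      forall j x, x \in X j ->
        c * (gamma ^+ d * 2 ^- (j * d)) <= w j x
          <= C * (gamma ^+ d * 2 ^- (j * d))
    & forall j (P : M -> R[i]), diffusion_polynomial lam u (2 ^ j)%N P ->
        (1 - eta) * L2norm mu P ^+ 2
          <= \sum_(x <- X j) w j x * cmod (P x) ^+ 2
          <= (1 + eta) * L2norm mu P ^+ 2].

(* Main.v *)
(* Since the generators are band-limited, the coefficients of f at scale j are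
   the weighted values, at the quadrature points, of the diffusion polynomial
   sum_l conj(h^(lam_l/2^j)) <f, u_l> u_l.  The Marcinkiewicz-Zygmund inequality
   and Pythagoras compare their square sum, up to factors 1 - eta and 1 + eta,
   with the energy sum_l |h^(lam_l/2^j)|^2 |<f, u_l>|^2.  By the refinement
   identity these energies telescope: up to scale n they add up to
   sum_l |alpha^(lam_l/2^n)|^2 |<f, u_l>|^2, which is at most |f|^2 by Bessel's
   inequality and tends to |f|^2 by completeness of the basis. *)
Require Import Defs.
From mathcomp Require Import all_boot all_order all_algebra finmap.
From mathcomp Require Import all_classical all_reals all_analysis.
From mathcomp Require Import measurable_realfun ring lra.
Import Order.TTheory GRing.Theory Num.Theory.
Import numFieldNormedType.Exports.
Local Open Scope classical_set_scope.
Local Open Scope ring_scope.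

Set Implicit Arguments.
Unset Strict Implicit.
Unset Printing Implicit Defensive.

(** * Algebra of real parts, imaginary parts and the squared modulus *)

Section complex_modulus.
Context {R : realType}.
Implicit Types z : R[i].

Lemma cmod_sqr z : cmod z ^+ 2 = complex.Re z ^+ 2 + complex.Im z ^+ 2.
Proof. by case: z => a b; rewrite sqr_sqrtr// addr_ge0// sqr_ge0. Qed.

Lemma mul_conjc z : z * conjc z = (cmod z ^+ 2)%:C%C.
Proof.
by rewrite cmod_sqr; case: z => a b; apply/eqP; rewrite eq_complex /=;
  apply/andP; split; apply/eqP; ring.
Qed.

Lemma cmod_conjc z : cmod (conjc z) = cmod z.
Proof. by case: z => a b /=; rewrite sqrrN. Qed.

Lemma ReD z1 z2 : complex.Re (z1 + z2) = complex.Re z1 + complex.Re z2.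
Proof. by case: z1 z2 => [? ?] []. Qed.

Lemma ImD z1 z2 : complex.Im (z1 + z2) = complex.Im z1 + complex.Im z2.
Proof. by case: z1 z2 => [? ?] []. Qed.

Lemma ReM z1 z2 : complex.Re (z1 * z2) =
  complex.Re z1 * complex.Re z2 - complex.Im z1 * complex.Im z2.
Proof. by case: z1 z2 => [? ?] []. Qed.

Lemma ImM z1 z2 : complex.Im (z1 * z2) =
  complex.Re z1 * complex.Im z2 + complex.Im z1 * complex.Re z2.
Proof. by case: z1 z2 => [? ?] []. Qed.

Lemma Re_conjc z : complex.Re (conjc z) = complex.Re z.
Proof. by case: z. Qed.

Lemma Im_conjc z : complex.Im (conjc z) = - complex.Im z.
Proof. by case: z. Qed.

Lemma Re_sum (I : Type) (s : seq I) (F : I -> R[i]) :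
  complex.Re (\sum_(i <- s) F i) = \sum_(i <- s) complex.Re (F i).
Proof. by elim/big_rec2: _ => // i x y _ <-; rewrite ReD. Qed.

Lemma cmodB_sqr z1 z2 : cmod (z1 - z2) ^+ 2 =
  cmod z1 ^+ 2 - 2 * complex.Re (conjc z2 * z1) + cmod z2 ^+ 2.
Proof. by rewrite !cmod_sqr; case: z1 z2 => a b [a' b'] /=; ring. Qed.

End complex_modulus.

(** * Calculus of the complex inner product on square-integrable functions *)

Section square_integrable.
Context {disp : measure_display} {T : measurableType disp} {R : realType}.
Variable mu : {measure set T -> \bar R}.
Implicit Types (f g : T -> R[i]) (c : R[i]).

Lemma integrable_lin (a b : R) (f g : T -> R) :
  mu.-integrable [set: T] (EFin \o f) -> mu.-integrable [set: T] (EFin \o g) ->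
  mu.-integrable [set: T] (EFin \o (fun x => a * f x + b * g x)).
Proof.
move=> fi gi.
apply: (eq_integrable measurableT
  (fun x => a%:E * (f x)%:E + b%:E * (g x)%:E)%E) => //.
by apply: integrableD => //; apply: integrableZl.
Qed.

Lemma Rintegral_lin (a b : R) (f g : T -> R) :
  mu.-integrable [set: T] (EFin \o f) -> mu.-integrable [set: T] (EFin \o g) ->
  \int[mu]_(x in [set: T]) (a * f x + b * g x) =
  a * \int[mu]_(x in [set: T]) f x + b * \int[mu]_(x in [set: T]) g x.
Proof.
move=> fi gi; rewrite RintegralD ?RintegralZl//.
- by apply: (eq_integrable measurableT (fun x => a%:E * (f x)%:E)%E) => //;
    exact: integrableZl.
- by apply: (eq_integrable measurableT (fun x => b%:E * (g x)%:E)%E) => //;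
    exact: integrableZl.
Qed.

Lemma cintegralD f g : cintegrable mu f -> cintegrable mu g ->
  cintegral mu (fun x => f x + g x) = cintegral mu f + cintegral mu g.
Proof.
move=> [fr fi] [gr gi]; apply/eqP; rewrite eq_complex /=; apply/andP; split.
- by under eq_Rintegral do rewrite ReD; rewrite RintegralD.
- by under eq_Rintegral do rewrite ImD; rewrite RintegralD.
Qed.

Lemma cintegralZ c f : cintegrable mu f ->
  cintegral mu (fun x => c * f x) = c * cintegral mu f.
Proof.
move=> [fr fi]; apply/eqP; rewrite eq_complex ReM ImM /=; apply/andP; split.
- under eq_Rintegral do rewrite ReM -mulNr.
  by rewrite Rintegral_lin// mulNr.
- under eq_Rintegral do rewrite ImM.
  by rewrite Rintegral_lin.
Qed.

Lemma L2_integrable f : L2 mu f ->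
  mu.-integrable [set: T] (EFin \o (fun x => cmod (f x) ^+ 2)).
Proof.
move=> [mr mi foo]; apply/integrableP; split.
  apply/measurable_EFinP.
  under eq_fun do rewrite cmod_sqr.
  by apply: measurable_funD; apply: measurable_funX.
by under eq_integral do rewrite /= ger0_norm ?sqr_ge0//.
Qed.

(** Single domination principle behind the integrability of products and of squared sums. The factor
    2 is the one needed for |f + g|^2 <= 2|f|^2 + 2|g|^2; products would need only 1/2. *)
Lemma L2_dominated f g (h : T -> R) : L2 mu f -> L2 mu g ->
  measurable_fun [set: T] h ->
  (forall x, `|h x| <= 2 * cmod (f x) ^+ 2 + 2 * cmod (g x) ^+ 2) ->
  mu.-integrable [set: T] (EFin \o h).
Proof.
move=> /L2_integrable fi /L2_integrable gi mh hle.
apply: le_integrable (integrable_lin 2 2 fi gi) => //.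
  exact/measurable_EFinP.
by move=> x _ /=; rewrite lee_fin (le_trans (hle x))// ler_norm.
Qed.

Lemma cintegrable_inner f g : L2 mu f -> L2 mu g ->
  cintegrable mu (fun x => f x * conjc (g x)).
Proof.
move=> f2 g2; have [fr fi _] := f2; have [gr gi _] := g2; split.
- apply: (L2_dominated f2 g2) => [|x].
    under eq_fun do rewrite ReM Re_conjc Im_conjc mulrN opprK.
    by apply: measurable_funD; apply: measurable_funM.
  rewrite ReM Re_conjc Im_conjc !cmod_sqr.
  case: (f x) (g x) => a b [a' b'] /=; rewrite ler_norml; apply/andP.
  (* The squares of sums and differences bound |aa'| and |bb'| by half sums of squares; the
     remaining squares supply the slack. *)
  have := (sqr_ge0 (a + a'), sqr_ge0 (a - a'), sqr_ge0 (b + b'),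
    sqr_ge0 (b - b'), sqr_ge0 a, sqr_ge0 a', sqr_ge0 b, sqr_ge0 b').
  by move=> [[[[[[[? ?] ?] ?] ?] ?] ?] ?]; split; nra.
- apply: (L2_dominated f2 g2) => [|x].
    under eq_fun do rewrite ImM Re_conjc Im_conjc mulrN addrC.
    by apply: measurable_funB; apply: measurable_funM.
  rewrite ImM Re_conjc Im_conjc !cmod_sqr.
  case: (f x) (g x) => a b [a' b'] /=; rewrite ler_norml; apply/andP.
  have := (sqr_ge0 (a + b'), sqr_ge0 (a - b'), sqr_ge0 (b + a'),
    sqr_ge0 (b - a'), sqr_ge0 a, sqr_ge0 a', sqr_ge0 b, sqr_ge0 b').
  by move=> [[[[[[[? ?] ?] ?] ?] ?] ?] ?]; split; nra.
Qed.

Lemma L2D f g : L2 mu f -> L2 mu g -> L2 mu (fun x => f x + g x).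
Proof.
move=> f2 g2; have [fr fi _] := f2; have [gr gi _] := g2.
have mr : measurable_fun [set: T] (fun x => complex.Re (f x + g x)).
  by under eq_fun do rewrite ReD; apply: measurable_funD.
have mi : measurable_fun [set: T] (fun x => complex.Im (f x + g x)).
  by under eq_fun do rewrite ImD; apply: measurable_funD.
split=> //.
have : mu.-integrable [set: T] (EFin \o (fun x => cmod (f x + g x) ^+ 2)).
  apply: (L2_dominated f2 g2) => [|x].
    under eq_fun do rewrite cmod_sqr.
    by apply: measurable_funD; apply: measurable_funX.
  rewrite ger0_norm ?sqr_ge0// !cmod_sqr.
  case: (f x) (g x) => a b [a' b'] /=.
  by have := (sqr_ge0 (a - a'), sqr_ge0 (b - b')) => -[? ?]; nra.
move=> /integrableP[_].
by under eq_integral do rewrite /= ger0_norm ?sqr_ge0//.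
Qed.

Lemma L2Z c f : L2 mu f -> L2 mu (fun x => c * f x).
Proof.
move=> f2; have [fr fi _] := f2; split.
- under eq_fun do rewrite ReM.
  by apply: measurable_funB; apply: measurable_funM.
- under eq_fun do rewrite ImM.
  by apply: measurable_funD; apply: measurable_funM.
- have /integrableP[_] := integrableZl measurableT (cmod c ^+ 2) (L2_integrable f2).
  congr (_ < _)%E; apply: eq_integral => x _ /=.
  rewrite ger0_norm ?ComplexField.Normc.normcM ?exprMn//.
  by apply: mulr_ge0; exact: sqr_ge0.
Qed.

Lemma L20 : L2 mu (fun=> 0).
Proof.
split; [exact: measurable_cst..|].
by under eq_integral do rewrite ComplexField.Normc.normc0 expr0n; rewrite integral0 ltry.
Qed.

Lemma L2_sum (u : nat -> T -> R[i]) (c : nat -> R[i]) N :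
  (forall l, L2 mu (u l)) -> L2 mu (fun x => \sum_(0 <= l < N) c l * u l x).
Proof.
move=> u2; elim: N => [|N IH].
  by under eq_fun do rewrite big_geq//; exact: L20.
under eq_fun do rewrite big_nat_recr//=.
exact/L2D/L2Z.
Qed.

Lemma innerDl f g h : L2 mu f -> L2 mu g -> L2 mu h ->
  inner mu (fun x => f x + g x) h = inner mu f h + inner mu g h.
Proof.
move=> f2 g2 h2; rewrite /inner -cintegralD; [|exact: cintegrable_inner..].
by congr cintegral; apply/funext => x; rewrite mulrDl.
Qed.

Lemma innerZl c f h : L2 mu f -> L2 mu h ->
  inner mu (fun x => c * f x) h = c * inner mu f h.
Proof.
move=> f2 h2; rewrite /inner -cintegralZ; last exact: cintegrable_inner.
by congr cintegral; apply/funext => x; rewrite mulrA.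
Qed.

Lemma inner_conj f g : L2 mu f -> L2 mu g ->
  inner mu g f = conjc (inner mu f g).
Proof.
move=> f2 g2; have [_ ii] := cintegrable_inner f2 g2.
apply/eqP; rewrite eq_complex /=; apply/andP; split; apply/eqP.
- apply: eq_Rintegral => x _; rewrite !ReM !Re_conjc !Im_conjc; ring.
- rewrite -[RHS]mulN1r -RintegralZl//.
  apply: eq_Rintegral => x _; rewrite !ImM !Re_conjc !Im_conjc; ring.
Qed.

Lemma inner_suml (u : nat -> T -> R[i]) (c : nat -> R[i]) N h :
  (forall l, L2 mu (u l)) -> L2 mu h ->
  inner mu (fun x => \sum_(0 <= l < N) c l * u l x) h =
  \sum_(0 <= l < N) c l * inner mu (u l) h.
Proof.
move=> u2 h2; elim: N => [|N IH].
  rewrite big_geq// /inner; apply/eqP; rewrite eq_complex /=.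
  by apply/andP; split; under eq_Rintegral do rewrite big_geq// mul0r /=;
    rewrite Rintegral_cst// mul0r.
rewrite big_nat_recr//= -IH -innerZl// -innerDl//.
- by congr inner; apply/funext => x; rewrite big_nat_recr.
- exact: L2_sum.
- exact: L2Z.
Qed.

Lemma inner_sumr (u : nat -> T -> R[i]) (c : nat -> R[i]) N f :
  (forall l, L2 mu (u l)) -> L2 mu f ->
  inner mu f (fun x => \sum_(0 <= l < N) c l * u l x) =
  \sum_(0 <= l < N) conjc (c l) * inner mu f (u l).
Proof.
move=> u2 f2; rewrite (inner_conj (L2_sum c N u2) f2) inner_suml// rmorph_sum.
by apply: eq_bigr => l _; rewrite rmorphM (@inner_conj (u l) f).
Qed.

Lemma inner_self f : inner mu f f = (L2norm mu f ^+ 2)%:C%C.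
Proof.
rewrite /L2norm sqr_sqrtr; last by apply: Rintegral_ge0 => x _; exact: sqr_ge0.
apply/eqP; rewrite eq_complex /=; apply/andP; split; apply/eqP.
- by apply: eq_Rintegral => x _; rewrite mul_conjc.
- under eq_Rintegral do rewrite mul_conjc /=.
  by rewrite Rintegral_cst// mul0r.
Qed.

Lemma L2normB_sqr f g : L2 mu f -> L2 mu g ->
  L2norm mu (fun x => f x - g x) ^+ 2 =
  L2norm mu f ^+ 2 - 2 * complex.Re (inner mu f g) + L2norm mu g ^+ 2.
Proof.
move=> f2 g2.
(* The difference is put in a form to which [innerDl] and [innerZl] apply; linearity is available in
   the first argument only, so [inner_conj] then swaps the arguments to expand the second. *)
have -> : (fun x => f x - g x) = (fun x => f x + (-1) * g x).
  by apply/funext => x; rewrite mulN1r.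
have q2 := L2Z (-1) g2; have fq2 := L2D f2 q2.
have := congr1 (@complex.Re R) (inner_self (fun x => f x + (-1) * g x)).
rewrite innerDl// innerZl// (inner_conj fq2 f2) (inner_conj fq2 g2).
rewrite !innerDl// !innerZl// (inner_conj f2 g2) !inner_self.
case: (inner mu f g) => a b; rewrite [in RHS in RHS -> _]/= => <- /=; ring.
Qed.

End square_integrable.

(** * Bessel's inequality and an approximate Parseval identity *)

Section orthonormal.
Context {disp : measure_display} {T : measurableType disp} {R : realType}.
Variable mu : {measure set T -> \bar R}.
Variable u : nat -> T -> R[i].
Hypothesis u_basis : orthonormal_basis mu u.

Let u2 l : L2 mu (u l). Proof. by have [] := u_basis. Qed.

Let u_orth l m : inner mu (u l) (u m) = (l == m)%:R.
Proof. by have [_ ] := u_basis. Qed.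

Lemma sum_inner_orthonormal (c : nat -> R[i]) N m :
  \sum_(0 <= l < N) c l * inner mu (u l) (u m) = if (m < N)%N then c m else 0.
Proof.
rewrite big_mkord; under eq_bigr do rewrite u_orth.
case: ifPn => [mN|mN].
  rewrite (bigD1 (Ordinal mN))//= eqxx mulr1 big1 ?addr0// => i.
  by rewrite -val_eqE /= => /negPf ->; rewrite mulr0.
rewrite big1// => i _; case: eqP => [im|]; last by rewrite mulr0.
by move: mN; rewrite -im ltn_ord.
Qed.

Lemma L2norm_sum (c : nat -> R[i]) N :
  L2norm mu (fun x => \sum_(0 <= l < N) c l * u l x) ^+ 2 =
  \sum_(0 <= l < N) cmod (c l) ^+ 2.
Proof.
apply: complexI; rewrite -inner_self inner_sumr//; last exact: L2_sum.
rewrite rmorph_sum /= !big_nat; apply: eq_bigr => l /andP[_ lN].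
by rewrite inner_suml// sum_inner_orthonormal lN mulrC mul_conjc.
Qed.

(** Completing the square in each coefficient. The last sum measures how far [c] is from the Fourier
    coefficients: it vanishes for Bessel and is dropped as nonnegative for Parseval. *)
Lemma L2norm_sub_sum f (c : nat -> R[i]) N : L2 mu f ->
  L2norm mu (fun x => f x - \sum_(0 <= l < N) c l * u l x) ^+ 2 =
  L2norm mu f ^+ 2 - \sum_(0 <= l < N) cmod (inner mu f (u l)) ^+ 2
  + \sum_(0 <= l < N) cmod (inner mu f (u l) - c l) ^+ 2.
Proof.
move=> f2; rewrite (L2normB_sqr f2 (L2_sum c N u2)) L2norm_sum inner_sumr//.
rewrite Re_sum mulr_sumr -!addrA; congr (_ + _).
rewrite -!sumrN -!big_split.
apply: eq_bigr => l _; rewrite cmodB_sqr.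
by move: (inner mu f (u l)) => z /=; ring.
Qed.

Lemma bessel f N : L2 mu f ->
  \sum_(0 <= l < N) cmod (inner mu f (u l)) ^+ 2 <= L2norm mu f ^+ 2.
Proof.
move=> f2; rewrite -subr_ge0.
have := L2norm_sub_sum (fun l => inner mu f (u l)) N f2.
rewrite [X in _ = _ + X]big1 ?addr0 => [<-|l _]; first exact: sqr_ge0.
by rewrite subrr ComplexField.Normc.normc0 expr0n.
Qed.

(** Density provides some combination close to [f], and the Fourier partial sum of the same length
    is at least as close. *)
Lemma parseval_approx f e : L2 mu f -> 0 < e -> exists N,
  L2norm mu f ^+ 2 - e <= \sum_(0 <= l < N) cmod (inner mu f (u l)) ^+ 2.
Proof.
(* Tolerance sqrt(e), because the norm enters squared. *)
move=> f2 e0; have [_ _ /(_ f f2 (Num.sqrt e))] := u_basis.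
rewrite sqrtr_gt0 => /(_ e0)[N [c fc]]; exists N.
have : L2norm mu (fun x => f x - \sum_(0 <= l < N) c l * u l x) ^+ 2 <= e.
  rewrite -[leRHS](sqr_sqrtr (ltW e0)).
  by apply: lerXn2r; rewrite ?nnegrE ?sqrtr_ge0// ltW.
rewrite L2norm_sub_sum//.
have : 0 <= \sum_(0 <= l < N) cmod (inner mu f (u l) - c l) ^+ 2.
  by apply: sumr_ge0 => l _; exact: sqr_ge0.
lra.
Qed.

End orthonormal.

(** * Passage from partial sums to series, and vanishing outside the band *)

Lemma nneseries_bounds (R : realType) (s L U : R) (b : nat -> R) (J : nat) :
  (forall j, 0 <= b j) ->
  (forall n, (J <= n)%N -> s + \sum_(J <= j < n) b j <= U) ->
  (forall e, 0 < e -> exists n, L - e <= s + \sum_(J <= j < n) b j) ->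
  (L%:E <= s%:E + \sum_(J <= j <oo) (b j)%:E)%E /\
  (s%:E + \sum_(J <= j <oo) (b j)%:E <= U%:E)%E.
Proof.
move=> b0 bU bL; split.
- apply/lee_addgt0Pr => e /bL[n Ln].
  rewrite -leeBlDr// -EFinB (@le_trans _ _ (s + \sum_(J <= j < n) b j)%:E)//.
  rewrite EFinD leeD2l// -sumEFin.
  by apply: nneseries_lim_ge => j _ _; rewrite lee_fin.
- rewrite addeC -leeBrDr// -EFinB; apply: lime_le.
    by apply: is_cvg_nneseries => j _ _; rewrite lee_fin.
  near=> n; rewrite sumEFin lee_fin.
  by rewrite lerBrDl bU//; near: n; exact: nbhs_infty_ge.
Unshelve. all: by end_near. Qed.

(** The partial sums are constant from [N] on, so the limits in [cseries] are genuine; this makes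
    the framelets finite sums. *)
Lemma cseries_finite (R : realType) (a : nat -> R[i]) N :
  (forall l, (N <= l)%N -> a l = 0) -> cseries a = \sum_(0 <= l < N) a l.
Proof.
move=> a0; have aN n : (N <= n)%N ->
    \sum_(0 <= l < n) a l = \sum_(0 <= l < N) a l.
  move=> Nn; rewrite (big_cat_nat (leq0n N) Nn)//= [X in _ + X]big1_seq ?addr0// => l.
  by rewrite mem_index_iota => /andP[_ /andP[/a0]].
apply/eqP; rewrite eq_complex /=; apply/andP; split; apply/eqP;
  apply/cvg_lim => //; apply: cvg_near_cst; exists N => // n /= Nn; by rewrite aN.
Qed.

Lemma fourier_eq0 (R : realType) (h : R -> R[i]) xi :
  support_fourier h `&` `[0, +oo[ `<=` `[0, 1] -> 1 < xi -> fourier h xi = 0.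
Proof.
move=> h01 xi1; apply/eqP; apply: contraTT xi1 => hxi; rewrite -leNgt.
have [|xi0] := leP 0 xi; last by rewrite ltW// (lt_trans xi0).
move=> xi0; have : `[0, 1]%classic xi.
  apply: h01; split; first exact: subset_closure.
  by rewrite /= in_itv/= xi0.
by rewrite /= in_itv/= xi0.
Qed.

(** * Framelet coefficients as samples of diffusion polynomials *)

Section framelet_coefficients.
Context {R : realType} {M : ptopologicalType}.
Variables (mu : {measure set (borel M) -> \bar R}).
Variables (lam : nat -> R) (u : nat -> M -> R[i]).
Hypothesis u_basis : orthonormal_basis (T := borel M) mu u.

(** Squared norm of the polynomial whose samples are the scale-[j] coefficients of [f], truncated at
    [N] so that all sums stay finite. *)
Definition energy (h : R -> R[i]) (j : nat) (f : M -> R[i]) (N : nat) : R :=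
  \sum_(0 <= l < N)
    cmod (fourier h (lam l / 2 ^+ j)) ^+ 2 *
    cmod (inner (T := borel M) mu f (u l)) ^+ 2.

Lemma frameletE h j N y x :
  (forall l, (N <= l)%N -> fourier h (lam l / 2 ^+ j) = 0) ->
  framelet lam u h j y x =
  \sum_(0 <= l < N) fourier h (lam l / 2 ^+ j) * conjc (u l y) * u l x.
Proof.
by move=> h0; apply: cseries_finite => l /h0 ->; rewrite !mul0r.
Qed.

(** The conjugate-linear second argument turns conj(u_l(y)) into u_l(y), so the coefficient becomes
    [a] times the value at [y] of a polynomial independent of [y]. *)
Lemma inner_framelet h j N y (a : R) f :
  (forall l, (N <= l)%N -> fourier h (lam l / 2 ^+ j) = 0) ->
  L2 (T := borel M) mu f ->
  inner mu f (fun z => a%:C%C * framelet lam u h j y z) =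
  a%:C%C * \sum_(0 <= l < N)
    (conjc (fourier h (lam l / 2 ^+ j)) * inner mu f (u l)) * u l y.
Proof.
move=> h0 f2; have [u2 _ _] := u_basis.
have -> : (fun z => a%:C%C * framelet lam u h j y z) = (fun z =>
    \sum_(0 <= l < N)
      (a%:C%C * (fourier h (lam l / 2 ^+ j) * conjc (u l y))) * u l z).
  apply/funext => z; rewrite (frameletE _ _ h0) mulr_sumr.
  by apply: eq_bigr => l _; rewrite !mulrA.
rewrite inner_sumr// mulr_sumr; apply: eq_bigr => l _.
rewrite !rmorphM [X in _ * (_ * X) * _]conjcK [X in X * _ * _]conjc_real.
by ring.
Qed.

(** The sampling level [m] is kept apart from the scale [j]: [alpha] is sampled at its own level
    [J], whereas [beta k] at scale [j] is sampled on the finer set of level [j.+1]. *)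
Lemma framelet_sum_bounds h j m N f (eta : R) (s : {fset M}) (w : M -> R) :
  (forall l, (2 ^+ m < lam l) -> fourier h (lam l / 2 ^+ j) = 0) ->
  (forall l, (N <= l)%N -> 2 ^+ m < lam l) ->
  (forall x, x \in s -> 0 < w x) ->
  (forall P : M -> R[i], diffusion_polynomial lam u (2 ^ m)%N P ->
     (1 - eta) * L2norm (T := borel M) mu P ^+ 2
       <= \sum_(x <- s) w x * cmod (P x) ^+ 2
       <= (1 + eta) * L2norm (T := borel M) mu P ^+ 2) ->
  L2 (T := borel M) mu f ->
  (1 - eta) * energy h j f N <=
  \sum_(x <- s) cmod (inner mu f
     (fun z => (Num.sqrt (w x))%:C%C * framelet lam u h j x z)) ^+ 2
  <= (1 + eta) * energy h j f N.
Proof.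
move=> h0 lamN w0 MZ f2.
pose c l := conjc (fourier h (lam l / 2 ^+ j)) * inner mu f (u l).
have /MZ : diffusion_polynomial lam u (2 ^ m)%N
    (fun x => \sum_(0 <= l < N) c l * u l x).
  (* The filter [lam l <= 2 ^ m] removes only terms with [c l = 0]. *)
  exists N, c; apply/funext => x; rewrite [RHS]big_mkcond/=.
  apply: eq_bigr => l _; rewrite natrX; case: ifPn => //; rewrite -ltNge => /h0.
  by rewrite /c => ->; rewrite conjc0 !mul0r.
rewrite (L2norm_sum u_basis).
have -> : \sum_(0 <= l < N) cmod (c l) ^+ 2 = energy h j f N.
  by apply: eq_bigr => l _; rewrite ComplexField.Normc.normcM cmod_conjc exprMn.
rewrite [X in _ -> _ <= X <= _](eq_big_seq
  (fun x => w x * cmod (\sum_(0 <= l < N) c l * u l x) ^+ 2))// => x xs.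
rewrite (inner_framelet _ _ (N := N))//; last by move=> l /lamN /h0.
rewrite ComplexField.Normc.normcM exprMn; congr (_ * _).
by rewrite cmod_sqr /= expr0n addr0 sqr_sqrtr// ltW// w0.
Qed.

End framelet_coefficients.

(** * Telescoping of energies and the limit at fine scales *)

Section refinement.
Context {R : realType} {M : ptopologicalType}.
Variables (mu : {measure set (borel M) -> \bar R}).
Variables (lam : nat -> R) (u : nat -> M -> R[i]).
Variables (J r : nat) (alpha : R -> R[i]) (beta : 'I_r -> R -> R[i]).
Hypothesis refinement : forall j l, (J <= j)%N ->
  cmod (fourier alpha (lam l / 2 ^+ j.+1)) ^+ 2
  = cmod (fourier alpha (lam l / 2 ^+ j)) ^+ 2
    + \sum_(k < r) cmod (fourier (beta k) (lam l / 2 ^+ j)) ^+ 2.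

Lemma energy_telescope f N n : (J <= n)%N ->
  energy mu lam u alpha J f N +
    \sum_(J <= j < n) \sum_(k < r) energy mu lam u (beta k) j f N =
  energy mu lam u alpha n f N.
Proof.
elim: n => [|n IH]; first by rewrite leqn0 => /eqP <-; rewrite big_geq// addr0.
rewrite leq_eqVlt => /predU1P[->|]; first by rewrite big_geq// addr0.
rewrite ltnS => Jn; rewrite big_nat_recr//= addrA IH// exchange_big -big_split.
by apply: eq_bigr => l _; rewrite refinement// mulrDl mulr_suml.
Qed.

Hypothesis alpha_lim : forall l,
  cmod (fourier alpha (lam l / 2 ^+ j)) @[j --> \oo] --> (1 : R).

Lemma alpha_sqr_cvg l :
  cmod (fourier alpha (lam l / 2 ^+ j)) ^+ 2 @[j --> \oo] --> (1 : R).
Proof.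
rewrite -[X in _ --> X](expr1n _ 2); under eq_fun do rewrite expr2.
by rewrite expr2; apply: cvgM; exact: alpha_lim.
Qed.

(** By refinement these values are nondecreasing in the scale from [J] on, hence bounded by their
    limit 1. The sequence is shifted by [j] and compared with its limit at index 0. *)
Lemma alpha_sqr_le1 j l : (J <= j)%N ->
  cmod (fourier alpha (lam l / 2 ^+ j)) ^+ 2 <= 1.
Proof.
move=> Jj; pose a n := cmod (fourier alpha (lam l / 2 ^+ (n + j))) ^+ 2.
have a_cvg : a n @[n --> \oo] --> (1 : R).
  rewrite (cvg_shiftn j (fun n => cmod (fourier alpha (lam l / 2 ^+ n)) ^+ 2)).
  exact: alpha_sqr_cvg.
have a_nd : nondecreasing_seq a.
  apply/nondecreasing_seqP => n; rewrite /a addSn refinement.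
    by rewrite lerDl sumr_ge0// => k _; exact: sqr_ge0.
  by rewrite (leq_trans Jj)// leq_addl.
have := nondecreasing_cvgn_le a_nd (cvgP _ a_cvg) 0.
by rewrite (cvg_lim _ a_cvg).
Qed.

Lemma energy_alpha_le j f N : (J <= j)%N ->
  energy mu lam u alpha j f N <=
  \sum_(0 <= l < N) cmod (inner (T := borel M) mu f (u l)) ^+ 2.
Proof.
move=> Jj; apply: ler_sum => l _.
by rewrite ler_piMl ?sqr_ge0// alpha_sqr_le1.
Qed.

Lemma energy_le h j f N N' : (N <= N')%N ->
  energy mu lam u h j f N <= energy mu lam u h j f N'.
Proof.
move=> NN'; rewrite /energy (big_cat_nat (leq0n N) NN')/= lerDl.
by apply: sumr_ge0 => l _; apply: mulr_ge0; exact: sqr_ge0.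
Qed.

(** For fixed [N] the limit passes through a finite sum term by term; no uniformity in [l] is
    required. *)
Lemma energy_alpha_cvg f N : energy mu lam u alpha j f N @[j --> \oo] -->
  \sum_(0 <= l < N) cmod (inner (T := borel M) mu f (u l)) ^+ 2.
Proof.
elim: N => [|N IH].
  rewrite /energy big_geq//; under eq_fun do rewrite big_geq//; exact: cvg_cst.
rewrite big_nat_recr//= /energy; under eq_fun do rewrite big_nat_recr//=.
apply: cvgD => //; rewrite -[X in _ --> X]mul1r; apply: cvgMl.
exact: alpha_sqr_cvg.
Qed.

End refinement.

(** * Assembly of the sampling bounds into frame bounds *)

Theorem theorem4p1 (R : realType) (d : nat) (M : ptopologicalType)
  (G : riemannian_manifold R d M)
  (M_compact : compact [set: M]) (M_connected : connected [set: M])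
  (mu : probability (borel M) R) (mu_volume : normalized_volume G mu)
  (lam : nat -> R) (u : nat -> M -> R[i])
  (u_basis : orthonormal_basis mu u)
  (u_eigen : forall l, laplace_eigenfunction G (lam l) (u l))
  (lam_0 : lam 0%N = 0)
  (lam_ndecr : forall l, lam l <= lam l.+1)
  (lam_cvg : lam l @[l --> \oo] --> +oo)
  (c C : R) (c_gt0 : 0 < c) (C_gt0 : 0 < C)
  (J0 J : nat) (J0_le_J : (J0 <= J)%N)
  (r : nat) (r_gt0 : (0 < r)%N)
  (alpha : R -> R[i]) (beta : 'I_r -> R -> R[i])
  (alpha_L1 : cintegrable lebesgue_measure alpha)
  (beta_L1 : forall k, cintegrable lebesgue_measure (beta k))
  (alpha_lim : forall l,
     cmod (fourier alpha (lam l / 2 ^+ j)) @[j --> \oo] --> (1 : R))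
  (refinement : forall j l, (J <= j)%N ->
     cmod (fourier alpha (lam l / 2 ^+ j.+1)) ^+ 2
     = cmod (fourier alpha (lam l / 2 ^+ j)) ^+ 2
       + \sum_(k < r) cmod (fourier (beta k) (lam l / 2 ^+ j)) ^+ 2)
  (support01 :
     (support_fourier alpha `&` `[0, +oo[)
       `|` \bigcup_(k in [set: 'I_r]) (support_fourier (beta k) `&` `[0, +oo[)
     `<=` `[0, 1])
  (eta : R) (eta_gt0 : 0 < eta) (eta_lt1 : eta < 1)
  (gamma : R) (gamma_gt0 : 0 < gamma)
  (X : nat -> {fset M}) (w : nat -> M -> R)
  (MZ : dyadic_nested_MZ d mu lam u c C eta gamma X w)
  (f : M -> R[i]) (f_L2 : L2 (T := borel M) mu f) :
  let phi j x : M -> R[i] := framelet lam u alpha j x in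
  let psi k j x : M -> R[i] := framelet lam u (beta k) j x in
  let coefs :=
    (\sum_(x <- X J)
       (cmod (inner mu f (fun z => (Num.sqrt (w J x))%:C%C * phi J x z)) ^+ 2)%:E
     + \sum_(J <= j <oo) \sum_(k < r) \sum_(x <- X j.+1)
       (cmod (inner mu f (fun z => (Num.sqrt (w j.+1 x))%:C%C * psi k j x z))
          ^+ 2)%:E)%E in
  (((1 - eta) * L2norm mu f ^+ 2)%:E <= coefs)%E /\
  (coefs <= ((1 + eta) * L2norm mu f ^+ 2)%:E)%E.
Proof.
move=> phi psi coefs.
have [_ w_gt0 _ _ MZP] := MZ.
have supp_alpha : support_fourier alpha `&` `[0, +oo[ `<=` `[0, 1].
  by apply: subset_trans support01; exact: subsetUl.
have supp_beta k : support_fourier (beta k) `&` `[0, +oo[ `<=` `[0, 1].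
  apply: subset_trans support01; apply: subset_trans (@subsetUr _ _ _).
  exact: (bigcup_sup (i := k)).
(* A frequency above 2^m >= 2^j is dilated beyond 1, outside the band. *)
have vanish h j m : (j <= m)%N -> support_fourier h `&` `[0, +oo[ `<=` `[0, 1] ->
    forall l, 2 ^+ m < lam l -> fourier h (lam l / 2 ^+ j) = 0.
  move=> jm supp_h l ml; apply: fourier_eq0 => //.
  rewrite ltr_pdivlMr ?exprn_gt0// mul1r (le_lt_trans _ ml)//.
  by rewrite ler_weXn2l// ler1n.
pose S := \sum_(x <- X J)
  cmod (inner mu f (fun z => (Num.sqrt (w J x))%:C%C * phi J x z)) ^+ 2.
pose B j := \sum_(k < r) \sum_(x <- X j.+1)
  cmod (inner mu f (fun z => (Num.sqrt (w j.+1 x))%:C%C * psi k j x z)) ^+ 2.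
have -> : coefs = (S%:E + \sum_(J <= j <oo) (B j)%:E)%E.
  rewrite /coefs sumEFin; congr (_ + _)%E; apply: eq_eseriesr => j _.
  by under eq_bigr do rewrite sumEFin; rewrite sumEFin.
have lam_large n : exists N0, forall N, (N0 <= N)%N ->
    forall l, (N <= l)%N -> 2 ^+ n < lam l.
  have /cvgryPgt /(_ (2 ^+ n)) [N0 _ HN0] := lam_cvg.
  by exists N0 => N N0N l Nl; apply: HN0 => /=; exact: leq_trans Nl.
(* One truncation serves every scale in the partial sum: [j < n] gives sampling level [j.+1 <= n],
   so all active frequencies are at most 2^n. The threshold [N0] depends on [n]. *)
have partial_bounds n : (J <= n)%N -> exists N0, forall N, (N0 <= N)%N ->
    (1 - eta) * energy mu lam u alpha n f N <= S + \sum_(J <= j < n) B j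
      <= (1 + eta) * energy mu lam u alpha n f N.
  move=> Jn; have [N0 HN0] := lam_large n; exists N0 => N /HN0 {}HN0.
  have lamN m l : (m <= n)%N -> (N <= l)%N -> 2 ^+ m < lam l.
    move=> mn /HN0; apply: le_lt_trans.
    by rewrite ler_weXn2l// ler1n.
  have /andP[S1 S2] := framelet_sum_bounds u_basis
    (vanish _ _ _ (leqnn J) supp_alpha) (fun l => lamN J l Jn) (w_gt0 J) (MZP J)
    f_L2.
  have B12 j k : (j < n)%N -> (1 - eta) * energy mu lam u (beta k) j f N <=
      \sum_(x <- X j.+1) cmod (inner mu f
        (fun z => (Num.sqrt (w j.+1 x))%:C%C * psi k j x z)) ^+ 2 <=
      (1 + eta) * energy mu lam u (beta k) j f N.
    move=> jn; exact: (framelet_sum_bounds u_basis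
      (vanish _ _ _ (leqnSn j) (supp_beta k)) (fun l => lamN j.+1 l jn)
      (w_gt0 j.+1) (MZP j.+1) f_L2).
  rewrite -(energy_telescope mu u refinement f N Jn).
  apply/andP; split; rewrite mulrDr lerD// mulr_sumr;
    apply: ler_sum_nat => j /andP[_ jn]; rewrite mulr_sumr;
    by apply: ler_sum => k _; have /andP[] := B12 j k jn.
apply: nneseries_bounds.
- by move=> j; apply: sumr_ge0 => k _; apply: sumr_ge0 => x _; exact: sqr_ge0.
- move=> n Jn; have [N /(_ N (leqnn N)) /andP[_ /le_trans]] := partial_bounds n Jn.
  apply; rewrite ler_wpM2l ?addr_ge0 ?(ltW eta_gt0)//.
  by rewrite (le_trans (energy_alpha_le mu u refinement alpha_lim f N Jn))// bessel.
(* Half of [e] pays for truncating Parseval at [N1], half for replacing |alpha^|^2 by its limit.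
   [N1] is fixed before [n], and [N0] comes after it; taking their maximum is harmless because
   [energy] grows with the truncation. *)
- move=> e e0; have e20 : 0 < e / 2 by rewrite divr_gt0.
  have [N1 HN1] := parseval_approx u_basis f_L2 e20.
  have /cvgrPdist_lt /(_ _ e20) [n0 _ Hn0] :=
    @energy_alpha_cvg _ _ mu _ u _ alpha_lim f N1.
  pose n := maxn J n0; exists n.
  have [N0 HN0] := partial_bounds n (leq_maxl _ _).
  have /andP[lb _] := HN0 _ (leq_maxl N0 N1).
  apply: le_trans lb.
  have /ltr_normlW near_lim : `|\sum_(0 <= l < N1) cmod (inner mu f (u l)) ^+ 2
      - energy mu lam u alpha n f N1| < e / 2 := Hn0 n (leq_maxr _ _).
  have := energy_le mu lam u alpha n f (leq_maxr N0 N1).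
  set x := energy _ _ _ _ _ _ N1 in near_lim *; set y := energy _ _ _ _ _ _ _.
  move=> xy.
  have eta1 : 0 <= 1 - eta by rewrite subr_ge0 ltW.
  (* Chain: y >= x, x exceeds the Fourier sum up to [N1] minus e/2, and that sum is at least |f|^2 -
     e/2. *)
  have : (1 - eta) * (L2norm mu f ^+ 2 - e) <= (1 - eta) * y.
    by apply: ler_wpM2l => //; lra.
  (* The loss is (1 - eta) e, which is at most the allowed [e]. *)
  have : 0 <= eta * e by rewrite mulr_ge0 ?ltW.
  lra.
Qed.
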